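(* Let $(S_n)_{n\ge 1}$ be a demimartingale or a demisubmartingale, and let $\tau$ be a bounded stopping time, i.e. there is $M\in\mathbb{N}$ such that $P(\tau\le M)=1$. Assume that, for every $k=1,\ldots,M-1$, the indicator $I\{\tau=k\}$ is a componentwise nondecreasing function of $S_1,\ldots,S_k$. Then: (a) the pair $\{S_\tau,S_M\}$ is a demisubmartingale; (b) $E(S_\tau)\le E(S_M)$.
   Context: All random variables live on one probability space, and functions are understood to be Borel measurable. $I\{A\}$ denotes the indicator of the event $A$. A sequence of $L^1$ random variables $(S_n)_{n\ge1}$ is a demimartingale if for all $j\ge1$, $E[(S_{j+1}-S_j)f(S_1,\ldots,S_j)]\ge 0$ for all componentwise nondecreasing functions $f:\mathbb{R}^j\to\mathbb{R}$ for which the expectation is defined; it is a demisubmartingale if this is required only for nonnegative componentwise nondecreasing $f$. A pair $\{T_1,T_2\}$ of $L^1$ random variables is a demisubmartingale if $E[(T_2-T_1)f(T_1)]\ge0$ for every nonnegative nondecreasing $f:\mathbb{R}\to\mathbb{R}$ for which the expectation is defined. A stopping time is a random variable $\tau$ with values in $\{1,2,\ldots\}\cup\{\infty\}$ with $\{\tau\le j\}\in\sigma(S_1,\ldots,S_j)$ for every $j\ge1$. ''$I\{A\}$ is a componentwise nondecreasing function of $S_1,\ldots,S_k$'' means $I\{A\}=h(S_1,\ldots,S_k)$ for some componentwise nondecreasing function $h$ on $\mathbb{R}^k$. *)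

(* Defs.v *)
From HB Require Import structures.
From mathcomp Require Import all_boot all_order all_algebra.
From mathcomp Require Import all_classical all_reals all_analysis.

Set Implicit Arguments.
Unset Strict Implicit.
Unset Printing Implicit Defensive.

Import Order.TTheory GRing.Theory Num.Theory.
Import numFieldNormedType.Exports.

Local Open Scope classical_set_scope.
Local Open Scope ring_scope.

(* Sequences S_1, S_2, ... are modelled by S : nat -> T -> R whose value at
   index 0 is never used. *)

Definition nondecreasing_cw (R : realType) (n : nat) (f : n.-tuple R -> R) :
    Prop :=
  forall u v : n.-tuple R, (forall i, tnth u i <= tnth v i) -> f u <= f v.

(* X need not be integrable: E[X] exists in [-oo, +oo] as soon as E[X^+] and
   E[X^-] are not both infinite. *)
Definition expectation_defined d (T : measurableType d) (R : realType)
    (P : probability T R) (X : T -> R) : Prop :=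
  ('E_P[X^\+] +? - 'E_P[X^\-])%E.

(* (S_1, ..., S_n) *)
Definition initial d (T : measurableType d) (R : realType)
    (S : nat -> T -> R) (n : nat) (x : T) : n.-tuple R :=
  [tuple S i.+1 x | i < n].

Definition demimartingale d (T : measurableType d) (R : realType)
    (P : probability T R) (S : nat -> T -> R) : Prop :=
  (forall n, (0 < n)%N -> S n \in Lfun P 1%E) /\
  forall (j : nat) (f : j.-tuple R -> R), (0 < j)%N ->
    measurable_fun [set: j.-tuple R] f -> nondecreasing_cw f ->
    let X := fun x => (S j.+1 x - S j x) * f (initial S j x) in
    expectation_defined P X -> (0 <= 'E_P[X])%E.

Definition demisubmartingale d (T : measurableType d) (R : realType)
    (P : probability T R) (S : nat -> T -> R) : Prop :=
  (forall n, (0 < n)%N -> S n \in Lfun P 1%E) /\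
  forall (j : nat) (f : j.-tuple R -> R), (0 < j)%N ->
    measurable_fun [set: j.-tuple R] f -> nondecreasing_cw f ->
    (forall u, 0 <= f u) ->
    let X := fun x => (S j.+1 x - S j x) * f (initial S j x) in
    expectation_defined P X -> (0 <= 'E_P[X])%E.

Definition demisubmartingale_pair d (T : measurableType d) (R : realType)
    (P : probability T R) (T1 T2 : T -> R) : Prop :=
  [/\ T1 \in Lfun P 1%E, T2 \in Lfun P 1%E &
      forall f : R -> R,
        measurable_fun [set: R] f -> {homo f : x y / x <= y} ->
        (forall x, 0 <= f x) ->
        let X := fun x => (T2 x - T1 x) * f (T1 x) in
        expectation_defined P X -> (0 <= 'E_P[X])%E].

(* Random times take values in option nat, where None stands for infinity. *)
Definition time_le T (tau : T -> option nat) (j : nat) : set T :=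
  [set x | exists2 n, tau x = Some n & (n <= j)%N].

(* g_sigma_preimage (fun i : 'I_j => S i.+1) is sigma(S_1, ..., S_j). *)
Definition stopping_time d (T : measurableType d) (R : realType)
    (S : nat -> T -> R) (tau : T -> option nat) : Prop :=
  (forall x, tau x <> Some 0%N) /\
  forall j, (0 < j)%N ->
    g_sigma_preimage (fun i : 'I_j => S i.+1) (time_le tau j).

(* S_tau, with the convention S_tau = 0 where tau is infinite. *)
Definition stopped_value d (T : measurableType d) (R : realType)
    (S : nat -> T -> R) (tau : T -> option nat) (x : T) : R :=
  if tau x is Some n then S n x else 0.

Definition nondecreasing_indicator d (T : measurableType d) (R : realType)
    (S : nat -> T -> R) (k : nat) (A : set T) : Prop :=
  exists h : k.-tuple R -> R,
    [/\ measurable_fun [set: k.-tuple R] h, nondecreasing_cw h &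
        forall x, \1_A x = h (initial S k x)].

(* Main.v *)
Require Import Defs.
From HB Require Import structures.
From mathcomp Require Import all_boot all_order all_algebra.
From mathcomp Require Import all_classical all_reals all_analysis.
From mathcomp Require Import measurable_realfun.

(** A demimartingale is a demisubmartingale, so suppose that [S] is one. Let [g]
    be nonnegative and nondecreasing. Almost surely [tau <= M], and then
    telescoping gives
      [(S_M - S_tau) g(S_tau)
         = sum_(1 <= j < M) (S_(j+1) - S_j) I{tau <= j} g(S_tau)]
    ([stopped_increments]). The factor
      [I{tau <= j} g(S_tau) = sum_(1 <= k <= j) I{tau = k} g(S_k)]
    is a sum of products of nonnegative nondecreasing functions of
    [S_1, ..., S_j], because each [I{tau = k}] with [k < M] is nondecreasing
    ([nondecreasing_past_stopped]). It is therefore an admissible multiplier of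
    [S_(j+1) - S_j]. If [g] is bounded, all terms are integrable and each has a
    nonnegative expectation, hence so does the sum ([stopped_bounded_ge0]).
    With [g = 1] this gives the integrability of [S_tau] and the
    inequality between the expectations.

    An unbounded [g] is the limit of its truncations [min(g, n)], which are
    again nonnegative and nondecreasing; the inequality passes to the limit as
    soon as the limiting expectation is defined ([expectationM_ge0_trunc]). *)

Set Implicit Arguments.
Unset Strict Implicit.
Unset Printing Implicit Defensive.

Import Order.TTheory GRing.Theory Num.Theory.

Local Open Scope classical_set_scope.
Local Open Scope ring_scope.

(** * Nonnegative nondecreasing functions of the past *)

(** [F] is a nonnegative, componentwise nondecreasing, Borel function of
    [S_1, ..., S_j]: an admissible multiplier of the increment
    [S_(j+1) - S_j] of a demisubmartingale. The witness [f] is required to be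
    nonnegative on all tuples, not only on the values of the process. *)
Definition nondecreasing_past d (T : measurableType d) (R : realType)
    (S : nat -> T -> R) (j : nat) (F : T -> R) : Prop :=
  exists f : j.-tuple R -> R,
    [/\ measurable_fun [set: j.-tuple R] f, nondecreasing_cw f,
        forall u, 0 <= f u &
        forall x, F x = f (initial S j x)].

Section Past.
Context (d : measure_display) (T : measurableType d) (R : realType).
Variable S : nat -> T -> R.

Lemma nondecreasing_past0 j : nondecreasing_past S j (cst 0).
Proof. by exists (cst 0); split => //. Qed.

Lemma nondecreasing_pastD j F G : nondecreasing_past S j F ->
  nondecreasing_past S j G -> nondecreasing_past S j (F \+ G).
Proof.
move=> [f [mf ndf f0 Ff]] [g [mg ndg g0 Gg]]; exists (f \+ g); split.
- exact: measurable_funD.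
- by move=> u v uv /=; rewrite lerD ?ndf ?ndg.
- by move=> u /=; rewrite addr_ge0.
- by move=> x /=; rewrite Ff Gg.
Qed.

Lemma nondecreasing_pastM j F G : nondecreasing_past S j F ->
  nondecreasing_past S j G -> nondecreasing_past S j (F \* G).
Proof.
move=> [f [mf ndf f0 Ff]] [g [mg ndg g0 Gg]]; exists (f \* g); split.
- exact: measurable_funM.
- by move=> u v uv /=; rewrite ler_pM ?ndf ?ndg.
- by move=> u /=; rewrite mulr_ge0.
- by move=> x /=; rewrite Ff Gg.
Qed.

Lemma nondecreasing_pastS j F :
  nondecreasing_past S j F -> nondecreasing_past S j.+1 F.
Proof.
move=> [f [mf ndf f0 Ff]].
pose r (u : j.+1.-tuple R) := [tuple tnth u (widen_ord (leqnSn j) i) | i < j].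
exists (f \o r); split.
- apply: measurableT_comp => //; apply/measurable_fun_tnthP => i.
  rewrite (_ : _ \o _ = (@tnth _ _)^~ (widen_ord (leqnSn j) i)).
    exact: measurable_tnth.
  by apply/funext => u /=; rewrite tnth_mktuple.
- by move=> u v uv; apply: ndf => i; rewrite !tnth_mktuple.
- by move=> u; exact: f0.
- move=> x /=; rewrite Ff; congr (f _).
  by apply: eq_from_tnth => i; rewrite /initial !tnth_mktuple.
Qed.

Lemma nondecreasing_past_last j (g : R -> R) :
  measurable_fun [set: R] g -> {homo g : x y / x <= y} ->
  (forall y, 0 <= g y) -> nondecreasing_past S j.+1 (g \o S j.+1).
Proof.
move=> mg ndg g0; exists (fun u => g (tnth u ord_max)); split => //.
- by apply: measurableT_comp => //; exact: measurable_tnth.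
- by move=> u v uv; exact: ndg.
- by move=> x /=; rewrite /initial tnth_mktuple.
Qed.

(** A function [h] representing [\1_A] may be negative off the values of the
    process, whence the positive part. *)
Lemma nondecreasing_past_indic k (A : set T) :
  nondecreasing_indicator S k A -> nondecreasing_past S k \1_A.
Proof.
move=> [h [mh ndh Ah]]; exists (h^\+); split.
- exact: measurable_funrpos.
- move=> u v uv; rewrite /funrpos ge_max !le_max ndh//=.
  by rewrite lexx orbT.
- by move=> u; exact: funrpos_ge0.
- move=> x; have := Ah x; rewrite /funrpos => <-.
  by rewrite max_l.
Qed.

End Past.

(** * Expectations *)

Section Expectation.
Context (d : measure_display) (T : measurableType d) (R : realType).
Variable P : probability T R.

Lemma Lfun1_measurable (X : T -> R) :
  X \in Lfun P 1%E -> measurable_fun [set: T] X.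
Proof. by move=> /Lfun1_integrable/measurable_int/measurable_EFinP. Qed.

Lemma Lfun1M_bounded (X F : T -> R) (C : R) : X \in Lfun P 1%E ->
  measurable_fun [set: T] F -> (forall x, 0 <= F x <= C) ->
  X \* F \in Lfun P 1%E.
Proof.
move=> /Lfun1_integrable iX mF FC; apply/Lfun1_integrable.
apply: (@integrableMl _ _ _ P setT measurableT (EFin \o X) F iX mF).
exists C; split; first exact: num_real.
move=> y Cy x _ /=; have /andP[F0 FxC] := FC x.
by rewrite ger0_norm// (le_trans FxC)// ltW.
Qed.

Lemma expectation_funrposE (X : T -> R) :
  ('E_P[X^\+] = \int[P]_x (EFin \o X)^\+ x)%E.
Proof. by rewrite unlock funerpos. Qed.

Lemma expectation_funrnegE (X : T -> R) :
  ('E_P[X^\-] = \int[P]_x (EFin \o X)^\- x)%E.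
Proof. by rewrite unlock funerneg. Qed.

Lemma expectation_funrposneg (X : T -> R) :
  ('E_P[X] = 'E_P[X^\+] - 'E_P[X^\-])%E.
Proof.
by rewrite expectation_funrposE expectation_funrnegE unlock integralE.
Qed.

Lemma expectation_definedL1 (X : T -> R) :
  X \in Lfun P 1%E -> expectation_defined P X.
Proof.
move=> /Lfun1_integrable/(integrable_add_def measurableT).
by rewrite /expectation_defined expectation_funrposE expectation_funrnegE.
Qed.

Lemma ae_eq_expectation (X Y : T -> R) : measurable_fun [set: T] X ->
  Y \in Lfun P 1%E -> {ae P, forall x, X x = Y x} ->
  X \in Lfun P 1%E /\ ('E_P[X] = 'E_P[Y])%E.
Proof.
move=> mX LY XY; have mY := Lfun1_measurable LY; split; last first.
  rewrite unlock; apply: ae_eq_integral => //; try exact/measurable_EFinP.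
  by apply: filterS XY => x /= ->.
apply/Lfun1_integrable/integrableP; split; first exact/measurable_EFinP.
move/Lfun1_integrable/integrableP : LY => [_]; apply: le_lt_trans.
rewrite le_eqVlt; apply/orP; left; apply/eqP.
apply: ae_eq_integral => //.
- by apply: measurableT_comp => //; exact/measurable_EFinP.
- by apply: measurableT_comp => //; exact/measurable_EFinP.
by apply: filterS XY => x /= ->.
Qed.

Lemma expectation_sum_ge0 (m n : nat) (X : nat -> T -> R) :
  (forall j, (m <= j < n)%N -> X j \in Lfun P 1%E) ->
  (forall j, (m <= j < n)%N -> (0 <= 'E_P[X j])%E) ->
  (fun x => \sum_(m <= j < n) X j x) \in Lfun P 1%E /\
  (0 <= 'E_P[fun x => (\sum_(m <= j < n) X j x)%R])%E.
Proof.
move=> LX X0; rewrite -fct_sumE; split.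
  by rewrite big_seq; apply: rpred_sum => j; rewrite mem_index_iota; exact: LX.
rewrite -(big_map X xpredT id) expectation_sum.
  rewrite big_map big_seq; apply: sume_ge0 => j; rewrite mem_index_iota.
  exact: X0.
by move=> Y /mapP[j]; rewrite mem_index_iota => /LX LXj ->.
Qed.

Lemma funrposM_ge0 (Y G : T -> R) x : 0 <= G x ->
  (Y \* G)^\+ x = Y^\+ x * G x.
Proof. by move=> G0; rewrite /funrpos maxr_pMl// mul0r. Qed.

Lemma funrnegM_ge0 (Y G : T -> R) x : 0 <= G x ->
  (Y \* G)^\- x = Y^\- x * G x.
Proof. by move=> G0; rewrite /funrneg maxr_pMl// mul0r mulNr. Qed.

(** [E[Y G]] may be infinite. By truncation, [E[(Y G_n)^-]] is at most
    [E[(Y G_n)^+] <= E[(Y G)^+]], where [G_n = min(G, n)]; monotone convergence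
    on the left gives [E[(Y G)^-] <= E[(Y G)^+]], and the two sides are not
    both infinite. *)
Lemma expectationM_ge0_trunc (Y G : T -> R) :
  measurable_fun [set: T] Y -> measurable_fun [set: T] G ->
  (forall x, 0 <= G x) ->
  (forall n, 0 <= 'E_P[Y \* (fun x => Num.min (G x) n%:R)])%E ->
  expectation_defined P (Y \* G) -> (0 <= 'E_P[Y \* G])%E.
Proof.
move=> mY mG G0 trunc0 YGdef.
pose Gn n x := Num.min (G x) n%:R.
have Gn0 n x : 0 <= Gn n x by rewrite /Gn le_min G0 ler0n.
have mGn n : measurable_fun [set: T] (Gn n) by exact: measurable_minr.
have mp (X : T -> R) : measurable_fun setT X ->
    measurable_fun setT (EFin \o X^\+).
  by move=> mX; apply/measurable_EFinP; exact: measurable_funrpos.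
have mn (X : T -> R) : measurable_fun setT X ->
    measurable_fun setT (EFin \o X^\-).
  by move=> mX; apply/measurable_EFinP; exact: measurable_funrneg.
have mYGn n := measurable_funM mY (mGn n).
have neg_le n : ('E_P[((Y \* Gn n)^\-)%R] <= 'E_P[((Y \* G)^\+)%R])%E.
  have : ('E_P[((Y \* Gn n)^\-)%R] <= 'E_P[((Y \* Gn n)^\+)%R])%E.
    have := trunc0 n; rewrite expectation_funrposneg.
    by move: ('E_P[_])%E ('E_P[_])%E => [a| |] [b| |]//=;
      rewrite ?lee_fin ?subr_ge0 ?leey ?leNye.
  move/le_trans; apply; rewrite unlock; apply: ge0_le_integral => //.
  - by move=> x _; rewrite lee_fin funrpos_ge0.
  - exact/mp.
  - exact/mp/measurable_funM.
  - move=> x _; rewrite lee_fin !funrposM_ge0//.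
    by rewrite ler_wpM2l// ?funrpos_ge0// /Gn ge_min lexx.
suff : ('E_P[((Y \* G)^\-)%R] <= 'E_P[((Y \* G)^\+)%R])%E.
  rewrite (expectation_funrposneg (Y \* G)); move: YGdef.
  rewrite /expectation_defined.
  by move: ('E_P[_])%E ('E_P[_])%E => [a| |] [b| |]//=;
    rewrite ?lee_fin ?subr_ge0 ?leey ?leNye.
pose h n x := ((Y \* Gn n)^\- x)%R%:E.
have cvgh x : h^~ x @ \oo --> ((Y \* G)^\- x)%R%:E.
  (* The sequence is constant once [n >= G x]. *)
  apply: cvg_near_cst; near=> n; rewrite /h !funrnegM_ge0//; congr (_ * _)%:E.
  rewrite /Gn min_l//; near: n; exact: nbhs_infty_ger.
have cvgE : (fun n => 'E_P[((Y \* Gn n)^\-)%R])%E @ \oo -->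
    'E_P[((Y \* G)^\-)%R]%E.
  rewrite unlock.
  rewrite [X in _ --> X](_ : _ = \int[P]_x limn (h^~ x))%E; last first.
    by apply: eq_integral => x _; rewrite (cvg_lim _ (cvgh x)).
  apply: (@cvg_monotone_convergence _ _ _ P _ measurableT h).
  - by move=> n; exact/mn.
  - by move=> n x _; rewrite lee_fin funrneg_ge0.
  - move=> x _ m n mn'; rewrite lee_fin !funrnegM_ge0//.
    by rewrite ler_wpM2l ?funrneg_ge0// le_min2 ?lexx ?ler_nat.
rewrite -(cvg_lim _ cvgE)//; apply: lime_le; last exact: nearW.
by apply/cvg_ex; eexists; exact: cvgE.
Unshelve. all: by end_near. Qed.

End Expectation.

(** * Stopping times and stopped values *)

Section StoppingTime.
Context (d : measure_display) (T : measurableType d) (R : realType).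
Variables (P : probability T R) (S : nat -> T -> R) (tau : T -> option nat).
Hypothesis mS : forall n, (0 < n)%N -> measurable_fun [set: T] (S n).
Hypothesis tauS : stopping_time S tau.

Lemma time_le0 : time_le tau 0 = set0.
Proof.
apply/seteqP; split => // x [n].
by rewrite leqn0 => + /eqP n0; rewrite n0; exact: tauS.1.
Qed.

Lemma measurable_time_le j : measurable (time_le tau j).
Proof.
case: j => [|j]; first by rewrite time_le0.
have := tauS.2 j.+1 isT; apply: smallest_sub.
  exact: sigma_algebra_measurable.
rewrite -bigcup_mkord_ord => A [i _ [B mB <-]].
exact: mS.
Qed.

Lemma time_leS j :
  time_le tau j.+1 = time_le tau j `|` [set x | tau x = Some j.+1].
Proof.
apply/seteqP; split => x /=.
- move=> [n taun]; rewrite leq_eqVlt => /orP[/eqP nj|nj]; last first.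
    by left; exists n.
  by right; rewrite taun nj.
- by move=> [[n taun nj]|taun]; [exists n => //; exact: leqW|exists j.+1].
Qed.

Lemma time_eqE j :
  [set x | tau x = Some j.+1] = time_le tau j.+1 `\` time_le tau j.
Proof.
apply/seteqP; split => x /=.
- move=> taux; split; first by exists j.+1.
  by move=> [n]; rewrite taux => -[<-]; rewrite ltnn.
- move=> [[n taun]]; rewrite leq_eqVlt => /orP[/eqP <-//|nj] [].
  by exists n.
Qed.

Lemma indic_time_leS j : \1_(time_le tau j.+1) =
  (\1_(time_le tau j) \+ \1_[set x | tau x = Some j.+1]) :> (T -> R).
Proof.
apply/funext => x /=; rewrite !indicE time_leS in_setU.
have [|//] := boolP (x \in time_le tau j) ; last by rewrite add0r.
rewrite time_eqE in_setD => -> /=.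
by rewrite andbF addr0.
Qed.

Lemma measurable_stopped_value : measurable_fun [set: T] (stopped_value S tau).
Proof.
have mtauE k : measurable [set x | tau x = Some k].
  case: k => [|k]; last first.
    by rewrite time_eqE; apply: measurableD; exact: measurable_time_le.
  rewrite (_ : mkset _ = set0)//; apply/seteqP; split => // x /=.
  by case: tauS => tau0 _ /tau0.
(* [E] enumerates the level sets of [tau]: index 0 is the level of infinity,
   and index [k.+1] that of the finite time [k]. *)
pose E n :=
  if n is k.+1 then [set x | tau x = Some k] else [set x | tau x = None].
have mlevel n : measurable (E n).
  case: n => [|n] /=; last exact: mtauE.
  rewrite (_ : mkset _ = ~` \bigcup_k [set x | tau x = Some k]).
    by apply: measurableC; exact: bigcup_measurable.
  apply/seteqP; split => x /=; first by move=> taux [k _ /=]; rewrite taux.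
  by case taux : (tau x) => [n|]// []; exists n.
have -> : [set: T] = \bigcup_n E n.
  apply/seteqP; split => x // _; case taux : (tau x) => [k|].
  - by exists k.+1.
  - by exists 0.
apply/measurable_fun_bigcup => // -[|[|k]].
- apply: (eq_measurable_fun (cst (0 : R))) => // x; rewrite inE /= => taux.
  by rewrite /stopped_value taux.
- rewrite (_ : E 1 = set0); first exact: measurable_fun_set0.
  by apply/seteqP; split => // x /=; case: tauS => tau0 _ /tau0.
- apply: (eq_measurable_fun (S k.+1)).
    by move=> x; rewrite inE /= => taux; rewrite /stopped_value taux.
  by apply: measurable_funTS; exact: mS.
Qed.

Lemma ae_time_le M : P (time_le tau M) = 1%E ->
  {ae P, forall x, time_le tau M x}.
Proof.
move=> PM; exists (~` time_le tau M); split => //.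
- exact/measurableC/measurable_time_le.
- by rewrite probability_setC ?PM ?subee//; exact: measurable_time_le.
Qed.

(** On [{tau <= M}], the increment [S_M - S_tau] is the sum of the increments
    [S_(j+1) - S_j] over [tau <= j < M]. *)
Lemma stopped_increments M (g : R -> R) x : time_le tau M x ->
  (S M x - stopped_value S tau x) * g (stopped_value S tau x) =
  \sum_(1 <= j < M) (S j.+1 x - S j x) *
    (\1_(time_le tau j) x * g (stopped_value S tau x)).
Proof.
move=> [m taum mM].
have m0 : (0 < m)%N.
  by case: m taum {mM} => // taum; case: tauS => /(_ x); rewrite taum.
have sE : stopped_value S tau x = S m x by rewrite /stopped_value taum.
have indE j : \1_(time_le tau j) x = (m <= j)%N%:R :> R.
  rewrite indicE; congr (nat_of_bool _)%:R; apply/idP/idP.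
    by rewrite inE => -[n]; rewrite taum => -[->].
  by rewrite inE => mj; exists m.
rewrite sE (big_cat_nat m0 mM)/= big_nat big1 ?add0r.
  rewrite -(telescope_sumr (S^~ x) mM) big_distrl/= big_nat [RHS]big_nat.
  by apply: eq_bigr => j /andP[mj _]; rewrite indE mj mul1r.
by move=> j /andP[_ jm]; rewrite indE leqNgt jm mul0r mulr0.
Qed.

End StoppingTime.

(** * Optional sampling *)

Section OptionalSampling.
Context (d : measure_display) (T : measurableType d) (R : realType).
Variables (P : probability T R) (S : nat -> T -> R) (tau : T -> option nat).
Variable M : nat.
Hypothesis subS : demisubmartingale P S.
Hypothesis tauS : stopping_time S tau.
Hypothesis tauM : P (time_le tau M) = 1%E.
Hypothesis ndtau : forall k : nat, (1 <= k <= M - 1)%N ->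
  nondecreasing_indicator S k [set x | tau x = Some k].

Let mS n : (0 < n)%N -> measurable_fun [set: T] (S n).
Proof. by move=> n0; apply: Lfun1_measurable; exact: subS.1. Qed.

(** [I{tau <= j} g(S_tau)] is the sum over [k <= j] of [I{tau = k} g(S_k)];
    this is where the monotonicity of the indicators [I{tau = k}] enters. *)
Lemma nondecreasing_past_stopped j (g : R -> R) : (j < M)%N ->
  measurable_fun [set: R] g -> {homo g : x y / x <= y} ->
  (forall y, 0 <= g y) ->
  nondecreasing_past S j
    (fun x => \1_(time_le tau j) x * g (stopped_value S tau x)).
Proof.
move=> + mg ndg g0; elim: j => [_|j IH jM].
  rewrite (_ : (fun _ => _) = cst 0); first exact: nondecreasing_past0.
  by apply/funext => x; rewrite (time_le0 tauS) indic0 /= mul0r.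
rewrite (_ : (fun _ => _) =
  (fun x => \1_(time_le tau j) x * g (stopped_value S tau x)) \+
  (\1_[set x | tau x = Some j.+1] \* (g \o S j.+1))).
  apply: nondecreasing_pastD.
    by apply: nondecreasing_pastS; apply: IH; exact: ltnW.
  apply: nondecreasing_pastM; last exact: nondecreasing_past_last.
  apply: nondecreasing_past_indic; apply: ndtau.
  by rewrite /= subn1 -ltnS prednK// (leq_trans _ jM).
apply/funext => x /=; rewrite indic_time_leS /= mulrDl; congr (_ + _).
rewrite !indicE; case: (boolP (x \in _)); last by rewrite !mul0r.
by rewrite inE /= /stopped_value => ->.
Qed.

Lemma demisubmartingale_past_ge0 j (F : T -> R) (C : R) : (0 < j)%N ->
  nondecreasing_past S j F -> (forall x, F x <= C) ->
  (S j.+1 \- S j) \* F \in Lfun P 1%E /\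
  (0 <= 'E_P[((S j.+1 \- S j) \* F)%R])%E.
Proof.
move=> j0 [f [mf ndf f0 Ff]] FC.
have LI : (S j.+1 \- S j) \* F \in Lfun P 1%E.
  apply: (@Lfun1M_bounded _ _ _ _ _ _ C).
  - by apply: rpredB; apply: subS.1.
  - rewrite (_ : F = f \o (initial S j)); last by apply/funext => x; rewrite Ff.
    apply: measurableT_comp => //; apply/measurable_fun_tnthP => i.
    rewrite (_ : _ \o _ = S i.+1); first exact: mS.
    by apply/funext => x /=; rewrite tnth_mktuple.
  - by move=> x; rewrite FC Ff f0.
split => //.
have FE : (S j.+1 \- S j) \* F =
    (fun x => (S j.+1 x - S j x) * f (initial S j x)).
  by apply/funext => x /=; rewrite Ff.
rewrite FE; apply: subS.2 => //; rewrite -FE; exact: expectation_definedL1.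
Qed.

(** The case of a bounded [g], where every expectation is finite. *)
Lemma stopped_bounded_ge0 (g : R -> R) (C : R) : (0 < M)%N ->
  measurable_fun [set: R] g -> {homo g : x y / x <= y} ->
  (forall y, 0 <= g y <= C) ->
  let X := (S M \- stopped_value S tau) \* (g \o stopped_value S tau) in
  X \in Lfun P 1%E /\ (0 <= 'E_P[X])%E.
Proof.
move=> M0 mg ndg gC X.
have g0 y : 0 <= g y by have /andP[] := gC y.
have C0 : 0 <= C by have /andP[/le_trans] := gC 0; apply.
pose F j x := \1_(time_le tau j) x * g (stopped_value S tau x).
have FC j x : F j x <= C.
  rewrite /F indicE; case: (_ \in _); rewrite ?mul1r ?mul0r//.
  by have /andP[] := gC (stopped_value S tau x).
have Xj j : (1 <= j < M)%N -> (S j.+1 \- S j) \* F j \in Lfun P 1%E /\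
    (0 <= 'E_P[((S j.+1 \- S j) \* F j)%R])%E.
  move=> /andP[j0 jM]; apply: demisubmartingale_past_ge0 (FC j) => //.
  exact: nondecreasing_past_stopped.
have [LZ Z0] := @expectation_sum_ge0 _ _ _ P 1 M
  (fun j => (S j.+1 \- S j) \* F j)
  (fun j jM => (Xj j jM).1) (fun j jM => (Xj j jM).2).
have mtau : measurable_fun [set: T] (stopped_value S tau).
  exact: measurable_stopped_value.
have [LX ->//] : X \in Lfun P 1%E /\ ('E_P[X] = 'E_P[fun x =>
    (\sum_(1 <= j < M) ((S j.+1 \- S j) \* F j) x)%R])%E.
apply: ae_eq_expectation => //.
  apply: measurable_funM; last exact: measurableT_comp.
  by apply: measurable_funB => //; exact: mS.
have := ae_time_le mS tauS tauM; apply: filterS => x tauxM.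
exact: (stopped_increments tauS).
Qed.

End OptionalSampling.

Theorem theorem2p1 (d : measure_display) (T : measurableType d) (R : realType)
    (P : probability T R) (S : nat -> T -> R) (tau : T -> option nat)
    (M : nat) :
  demimartingale P S \/ demisubmartingale P S ->
  stopping_time S tau ->
  P (time_le tau M) = 1%E ->
  (forall k : nat, (1 <= k <= M - 1)%N ->
     nondecreasing_indicator S k [set x | tau x = Some k]) ->
  demisubmartingale_pair P (stopped_value S tau) (S M) /\
  ('E_P[stopped_value S tau] <= 'E_P[S M])%E.
Proof.
move=> demiS tauS tauM ndtau.
have subS : demisubmartingale P S.
  case: demiS => // -[L1 dS]; split => // j f j0 mf ndf _; exact: dS.
have M0 : (0 < M)%N.
  rewrite lt0n; apply/eqP => M0; move: tauM; rewrite M0.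
  by rewrite (time_le0 tauS) measure0 => /eqP; rewrite eq_sym onee_eq0.
(* The constant [g = 1] yields both the integrability of [S_tau] and the
   inequality between the expectations. *)
have [LD D0] : S M \- stopped_value S tau \in Lfun P 1%E /\
    (0 <= 'E_P[(S M \- stopped_value S tau)%R])%E.
  have [] := @stopped_bounded_ge0 _ _ _ P S tau M subS tauS tauM ndtau
    (cst 1) 1 M0 (measurable_cst _) (fun _ _ _ => lexx _).
    by move=> y /=; rewrite ler01 lexx.
  rewrite (_ : _ \* _ = S M \- stopped_value S tau)//.
  by apply/funext => x /=; rewrite mulr1.
have LSM : S M \in Lfun P 1%E by exact: subS.1.
have Ltau : stopped_value S tau \in Lfun P 1%E.
  rewrite (_ : stopped_value S tau = S M - (S M - stopped_value S tau)).
    exact: rpredB.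
  by rewrite opprB addrC subrK.
split; last first.
  move: D0; rewrite expectationB// sube_ge0//.
  by rewrite expectation_fin_num// orbT.
split => // g mg ndg g0 X Xdef.
have mtau := Lfun1_measurable Ltau.
apply: (@expectationM_ge0_trunc _ _ _ P (S M \- stopped_value S tau)
  (g \o stopped_value S tau)) => //.
- exact: Lfun1_measurable LD.
- exact: measurableT_comp.
- by move=> x; exact: g0.
move=> n.
have [] := @stopped_bounded_ge0 _ _ _ P S tau M subS tauS tauM ndtau
  (fun y => Num.min (g y) n%:R) n%:R M0 => //.
- exact: measurable_minr.
- by move=> y z yz; rewrite le_min2 ?ndg.
- by move=> y; rewrite le_min g0 ler0n /= ge_min lexx orbT.
Qed.
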